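(* Let $\mathcal D=(D,<,\rho)$ be a computable partially ordered set. Then: 1. $K^{\emptyset',D}<_{ct}\inf(K^{\mathcal D}_{\max},K^{\mathcal D}_{\min})$ (pointwise infimum). 2. $K^{\mathcal D}_{\max}\le_{ct}K^D$ and $K^{\mathcal D}_{\min}\le_{ct}K^D$, but they are not simultaneously much smaller than $K^D$: $$K^D\le_{ct}\big(K^{\mathcal D}_{\max}+\log(K^{\mathcal D}_{\max})\big)+\big(K^{\mathcal D}_{\min}+\log(K^{\mathcal D}_{\min})\big),$$ with the convention $\log(0)=0$.
   Context: A computable partially ordered set is a triple $\mathcal D=(D,<,\rho)$ where $\rho:\mathbb N\to D$ is a bijection and $<$ is a strict partial order on $D$ such that $\{(m,n):\rho(m)<\rho(n)\}$ is computable; a partial function $F$ from a space into $D$ is partial (resp. total) computable if $\rho^{-1}\circ F$ is. For a partial function $f:\{0,1\}^*\times\mathbb N\to D$ that is monotone increasing (w.r.t. $<$) in its second argument on its domain, $\max^{\mathcal D}f$ is the partial function defined exactly at those $p$ for which $\{f(p,t):t\in\mathbb N,\ f(p,t)\text{ defined}\}$ is finite and non-empty, with value the maximum element of that set. $\mathrm{Max}_{\mathrm{PR}}[\{0,1\}^*\to\mathcal D]$ is the class of all $\max^{\mathcal D}f$ with $f$ partial computable and monotone increasing in its second argument. For a partial $\varphi:\{0,1\}^*\to D$, $K_\varphi(d)=\min\{|p|:\varphi(p)=d\}$. $K^D$ is $K_\varphi$ for a $\varphi$ optimal among partial computable functions $\{0,1\}^*\to D$ (for every partial computable $\psi$ there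 is $c$ with $K_\varphi(d)\le K_\psi(d)+c$ whenever $K_\psi(d)$ is defined); $K^{\emptyset',D}$ is defined likewise using functions partial computable relative to the halting set $\emptyset'$. $K^{\mathcal D}_{\max}$ is $K_U$ for some $U$ optimal (in the same sense) within the class $\mathrm{Max}_{\mathrm{PR}}[\{0,1\}^*\to\mathcal D]$ (such $U$ exists), and $K^{\mathcal D}_{\min}$ is $K^{\mathcal D'}_{\max}$ where $\mathcal D'=(D,>,\rho)$ is the reverse order. These are total functions $D\to\mathbb N$ defined up to an additive constant. For $f,g:D\to\mathbb N$: $f\le_{ct}g$ iff $\exists c\,\forall d\ f(d)\le g(d)+c$; $f<_{ct}g$ iff $f\le_{ct}g$ and not $g\le_{ct}f$. *)

(* Defs.v *)
From Stdlib Require Import List Arith.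

Definition cpair (x y : nat) : nat := (x + y) * (x + y + 1) / 2 + y.

(* successor in the Cantor enumeration (x,y) with cpair x y = n *)
Definition cnext (p : nat * nat) : nat * nat :=
  match p with
  | (0, y) => (S y, 0)
  | (S x, y) => (x, S y)
  end.

Definition unpair (n : nat) : nat * nat := Nat.iter n cnext (0, 0).

Inductive code : Type :=
| cZero : code
| cSucc : code
| cId   : code
| cFst  : code
| cSnd  : code
| cOrc  : code
| cPair : code -> code -> code
| cComp : code -> code -> code
| cRec  : code -> code -> code
| cMu   : code -> code.

Inductive eval (A : nat -> Prop) : code -> nat -> nat -> Prop :=
| eZero x : eval A cZero x 0
| eSucc x : eval A cSucc x (S x)
| eId x : eval A cId x x
| eFst x : eval A cFst x (fst (unpair x))
| eSnd x : eval A cSnd x (snd (unpair x))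
| eOrc1 x : A x -> eval A cOrc x 1
| eOrc0 x : ~ A x -> eval A cOrc x 0
| ePair f g x y z : eval A f x y -> eval A g x z -> eval A (cPair f g) x (cpair y z)
| eComp f g x y z : eval A g x y -> eval A f y z -> eval A (cComp f g) x z
| eRec0 f g x a y : unpair x = (a, 0) -> eval A f a y -> eval A (cRec f g) x y
| eRecS f g x a n z y : unpair x = (a, S n) ->
    eval A (cRec f g) (cpair a n) z ->
    eval A g (cpair a (cpair n z)) y -> eval A (cRec f g) x y
| eMu f x n : eval A f (cpair x n) 0 ->
    (forall m, m < n -> exists k, eval A f (cpair x m) (S k)) ->
    eval A (cMu f) x n.

(* Goedel numbering of codes (surjective) *)
Fixpoint dec (fuel n : nat) : code :=
  match fuel with
  | 0 => cZero
  | S fu =>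
    let (t, a) := unpair n in
    match t with
    | 0 => cZero | 1 => cSucc | 2 => cId | 3 => cFst | 4 => cSnd | 5 => cOrc
    | 6 => let (a1, a2) := unpair a in cPair (dec fu a1) (dec fu a2)
    | 7 => let (a1, a2) := unpair a in cComp (dec fu a1) (dec fu a2)
    | 8 => let (a1, a2) := unpair a in cRec (dec fu a1) (dec fu a2)
    | 9 => cMu (dec fu a)
    | _ => cZero
    end
  end.

Definition decode (e : nat) : code := dec e e.

Definition noOracle : nat -> Prop := fun _ => False.
Definition Halt : nat -> Prop := fun e => exists y, eval noOracle (decode e) e y.

(* bijection {0,1}^* -> nat *)
Fixpoint enc (s : list bool) : nat :=
  match s with
  | nil => 0
  | b :: s' => S (2 * enc s' + (if b then 1 else 0))
  end.

Definition bijective_nat {D : Type} (rho : nat -> D) : Prop :=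
  (forall m n, rho m = rho n -> m = n) /\ (forall d, exists n, rho n = d).

Definition computable_poset {D : Type} (lt : D -> D -> Prop) (rho : nat -> D) : Prop :=
  (forall x, ~ lt x x) /\
  (forall x y z, lt x y -> lt y z -> lt x z) /\
  bijective_nat rho /\
  (exists c : code, forall m n,
      (lt (rho m) (rho n) -> eval noOracle c (cpair m n) 1) /\
      (~ lt (rho m) (rho n) -> eval noOracle c (cpair m n) 0)).

(* Partial functions {0,1}^* -> D are represented by their graphs. *)
Definition pfun (D : Type) := list bool -> D -> Prop.

Definition PC {D : Type} (A : nat -> Prop) (rho : nat -> D) (phi : pfun D) : Prop :=
  exists c : code, forall p n, eval A c (enc p) n <-> phi p (rho n).

Definition maxrel {D : Type} (lt : D -> D -> Prop)
  (f : list bool -> nat -> D -> Prop) (p : list bool) (d : D) : Prop :=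
  (exists t, f p t d) /\
  (exists l : list D, forall t e, f p t e -> In e l) /\
  (forall t e, f p t e -> e = d \/ lt e d).

Definition MaxPR {D : Type} (lt : D -> D -> Prop) (rho : nat -> D) (U : pfun D) : Prop :=
  exists f : list bool -> nat -> D -> Prop,
    (exists c : code, forall p t n,
        eval noOracle c (cpair (enc p) t) n <-> f p t (rho n)) /\
    (forall p t1 t2 e1 e2, t1 <= t2 -> f p t1 e1 -> f p t2 e2 -> e1 = e2 \/ lt e1 e2) /\
    (forall p d, U p d <-> maxrel lt f p d).

Definition isK {D : Type} (phi : pfun D) (d : D) (n : nat) : Prop :=
  (exists p, phi p d /\ length p = n) /\ (forall p, phi p d -> n <= length p).

Definition optimal {D : Type} (C : pfun D -> Prop) (phi : pfun D) : Prop :=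
  C phi /\
  forall psi, C psi -> exists c, forall d n, isK psi d n ->
    exists m, isK phi d m /\ m <= n + c.

Definition le_ct {D : Type} (f g : D -> nat) : Prop :=
  exists c, forall d, f d <= g d + c.

Definition lt_ct {D : Type} (f g : D -> nat) : Prop :=
  le_ct f g /\ ~ le_ct g f.

(* Main.v *)
(** The predicate "[d] is the maximum of the values [f p t]" says that [d] is reached at some [t] and
    never left afterwards, so the graph of a function of [MaxPR] is decidable, and not merely
    enumerable, relative to the halting set.  Hence such functions are partial computable in the
    halting set, and the latter can also find, from N, an element that no program among the first
    (N + 1)^2 describes for [U] or [V]: its complexity [K0] is at most log N + O(1) although
    [Kmax] and [Kmin] are both at least 2 log N.

    If [p] describes [d] for [U] and [q] describes [d] for [V], the increasing approximation of [d]
    given by [p] and the decreasing one given by [q] meet only at [d], so searching for a common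
    value computes [d] from the pair ([p], [q]).  Delimiting the shorter of the two strings
    costs twice the logarithm of its length, which is at most the sum of both logarithms. *)
Require Import Defs.
From Stdlib Require Import List Arith Lia Classical ClassicalEpsilon.
Import ListNotations.

Lemma nat_least (P : nat -> Prop) : (exists n, P n) -> exists n, P n /\ forall m, m < n -> ~ P m.
Proof.
  intros [n Hn]. revert Hn. induction n as [n IH] using lt_wf_ind. intros Hn.
  destruct (classic (exists m, m < n /\ P m)) as [(m & L & Hm)|N]; [eauto|].
  exists n; split; [assumption|]. intros m L Hm; eauto.
Qed.

(** * Computable total functions *)

(** The walk [cnext] follows the antidiagonals; from [(0, y)] it jumps to the next one, whose
    triangular number is larger by [y + 1]. *)
Lemma cpair_cnext x y : cpair (fst (cnext (x, y))) (snd (cnext (x, y))) = S (cpair x y).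
Proof.
  unfold cpair; destruct x as [|x]; cbn [cnext fst snd].
  - replace ((S y + 0) * (S y + 0 + 1)) with ((0 + y) * (0 + y + 1) + (y + 1) * 2) by lia.
    rewrite Nat.div_add by lia. lia.
  - replace (x + S y) with (S x + y) by lia. lia.
Qed.

Lemma cpair_unpair n : cpair (fst (unpair n)) (snd (unpair n)) = n.
Proof.
  induction n as [|n IH]; [reflexivity|].
  change (unpair (S n)) with (cnext (unpair n)).
  destruct (unpair n) as [x y]. rewrite cpair_cnext. simpl in IH. now rewrite IH.
Qed.

Lemma unpair_cpair x y : unpair (cpair x y) = (x, y).
Proof.
  remember (cpair x y) as n eqn:E. revert x y E.
  induction n as [|n IH]; intros x y E.
  - destruct y as [|y]; [destruct x as [|x]; [reflexivity|]|].
    + pose proof (cpair_cnext 0 x) as H. cbn in H. cbn in E. lia.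
    + unfold cpair in E; lia.
  - change (unpair (S n)) with (cnext (unpair n)).
    destruct y as [|y]; [destruct x as [|x]; [discriminate|]|].
    + rewrite (IH 0 x); [reflexivity|]. pose proof (cpair_cnext 0 x) as H. cbn [cnext fst snd] in H. lia.
    + rewrite (IH (S x) y); [reflexivity|]. pose proof (cpair_cnext (S x) y) as H. cbn [cnext fst snd] in H. lia.
Qed.

Lemma fst_unpair_cpair x y : fst (unpair (cpair x y)) = x.
Proof. now rewrite unpair_cpair. Qed.

Lemma snd_unpair_cpair x y : snd (unpair (cpair x y)) = y.
Proof. now rewrite unpair_cpair. Qed.

Lemma cpair_ge x y : x + y <= cpair x y.
Proof.
  unfold cpair.
  enough (x <= (x + y) * (x + y + 1) / 2) by lia.
  apply Nat.div_le_lower_bound; nia.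
Qed.

(** * Determinism of evaluation and closure properties of total computable functions *)

Section Evaluation.
Variable A : nat -> Prop.

Lemma eval_cRec_0 f g a y : eval A (cRec f g) (cpair a 0) y <-> eval A f a y.
Proof.
  split; intros H.
  - inversion H as [| | | | | | | | |? ? ? b ? E1 H1|? ? ? b ? ? ? E1|]; subst;
      rewrite unpair_cpair in E1; inversion E1; now subst.
  - eapply eRec0; [apply unpair_cpair|assumption].
Qed.

Lemma eval_cRec_S f g a n y :
  eval A (cRec f g) (cpair a (S n)) y <->
  exists z, eval A (cRec f g) (cpair a n) z /\ eval A g (cpair a (cpair n z)) y.
Proof.
  split.
  - intros H.
    inversion H as [| | | | | | | | |? ? ? b ? E1 H1|? ? ? b ? z ? E1|]; subst;
      rewrite unpair_cpair in E1; inversion E1; subst. eauto.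
  - intros (z & H1 & H2). eapply eRecS; [apply unpair_cpair| |]; eassumption.
Qed.

Lemma eval_cPair f g x v :
  eval A (cPair f g) x v <-> exists y z, eval A f x y /\ eval A g x z /\ v = cpair y z.
Proof.
  split.
  - intros H; inversion H; subst; eauto.
  - intros (y & z & H1 & H2 & ->). now constructor.
Qed.

Lemma eval_cComp f g x v : eval A (cComp f g) x v <-> exists y, eval A g x y /\ eval A f y v.
Proof.
  split.
  - intros H; inversion H; subst; eauto.
  - intros (y & H1 & H2). econstructor; eassumption.
Qed.

Lemma eval_cMu f x n :
  eval A (cMu f) x n <->
  eval A f (cpair x n) 0 /\ forall m, m < n -> exists k, eval A f (cpair x m) (S k).
Proof.
  split.
  - intros H; inversion H; subst; eauto.
  - intros [H1 H2]. now constructor.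
Qed.

Lemma eval_det c : forall x y z, eval A c x y -> eval A c x z -> y = z.
Proof.
  induction c as [| | | | | |f IHf g IHg|f IHf g IHg|f IHf g IHg|f IHf];
    intros x y z H1 H2;
    try (inversion H1; inversion H2; subst; congruence || contradiction).
  - apply eval_cPair in H1 as (y1 & z1 & Hf1 & Hg1 & ->), H2 as (y2 & z2 & Hf2 & Hg2 & ->).
    f_equal; eauto.
  - apply eval_cComp in H1 as (y1 & Hg1 & Hf1), H2 as (y2 & Hg2 & Hf2).
    assert (y1 = y2) by eauto. subst; eauto.
  - rewrite <- (cpair_unpair x) in H1, H2. revert H1 H2.
    generalize (fst (unpair x)) as a. generalize (snd (unpair x)) as n. clear x.
    intros n; revert y z; induction n as [|n IH]; intros y z a.
    + rewrite !eval_cRec_0. eauto.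
    + rewrite !eval_cRec_S. intros (u & Hu & Hy) (v & Hv & Hz).
      assert (u = v) by eauto. subst; eauto.
  - apply eval_cMu in H1 as [Hy0 Hy], H2 as [Hz0 Hz].
    (* The smaller of two distinct results would be a zero of [f] and also an argument with a
       positive value. *)
    destruct (Nat.lt_trichotomy y z) as [L|[L|L]]; [|assumption|].
    + destruct (Hz _ L) as [k Hk]. discriminate (IHf _ _ _ Hy0 Hk).
    + destruct (Hy _ L) as [k Hk]. discriminate (IHf _ _ _ Hz0 Hk).
Qed.

(** The oracle stays arbitrary so that the same closure properties serve [noOracle] and [Halt]. *)
Definition tot (F : nat -> nat) : Prop := exists c, forall x, eval A c x (F x).

Definition tot2 (F : nat -> nat -> nat) : Prop :=
  tot (fun w => F (fst (unpair w)) (snd (unpair w))).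

Lemma tot_ext F G : (forall x, F x = G x) -> tot F -> tot G.
Proof. intros E [c H]. exists c. intros x. now rewrite <- E. Qed.

Lemma tot_id : tot (fun x => x).
Proof. exists cId. constructor. Qed.

Lemma tot_comp F G : tot F -> tot G -> tot (fun x => F (G x)).
Proof. intros [f Hf] [g Hg]. exists (cComp f g). intros x. econstructor; eauto. Qed.

Lemma tot_pair F G : tot F -> tot G -> tot (fun x => cpair (F x) (G x)).
Proof. intros [f Hf] [g Hg]. exists (cPair f g). intros x. econstructor; eauto. Qed.

Lemma tot_fst F : tot F -> tot (fun x => fst (unpair (F x))).
Proof. apply (tot_comp (fun x => fst (unpair x))). exists cFst. constructor. Qed.

Lemma tot_snd F : tot F -> tot (fun x => snd (unpair (F x))).
Proof. apply (tot_comp (fun x => snd (unpair x))). exists cSnd. constructor. Qed.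

Lemma tot_S F : tot F -> tot (fun x => S (F x)).
Proof. apply (tot_comp S). exists cSucc. constructor. Qed.

Lemma tot_const k : tot (fun _ => k).
Proof.
  induction k as [|k IH]; [exists cZero; constructor|]. now apply tot_S.
Qed.

Lemma tot2_app F G H : tot2 F -> tot G -> tot H -> tot (fun x => F (G x) (H x)).
Proof.
  intros HF HG HH.
  apply (tot_ext (fun x => (fun w => F (fst (unpair w)) (snd (unpair w))) (cpair (G x) (H x)))).
  - intros x. now rewrite unpair_cpair.
  - apply (tot_comp (fun w => F (fst (unpair w)) (snd (unpair w)))); [assumption|].
    now apply tot_pair.
Qed.

(** The step function reads parameter, counter and previous value from [cpair a (cpair n r)], the
    form in which [cRec] presents them. *)
Lemma tot_rec B St N :
  tot B ->
  tot (fun w => St (fst (unpair w)) (fst (unpair (snd (unpair w)))) (snd (unpair (snd (unpair w))))) ->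
  tot N ->
  tot (fun x => nat_rect (fun _ => nat) (B x) (fun n r => St x n r) (N x)).
Proof.
  intros [b Hb] [s Hs] HN.
  assert (H : forall a n, eval A (cRec b s) (cpair a n)
                (nat_rect (fun _ => nat) (B a) (fun n r => St a n r) n)).
  { intros a n. induction n as [|n IH].
    - now apply eval_cRec_0.
    - apply eval_cRec_S. eexists; split; [exact IH|].
      specialize (Hs (cpair a (cpair n (nat_rect (fun _ => nat) (B a) (fun n r => St a n r) n)))).
      rewrite !snd_unpair_cpair, !fst_unpair_cpair in Hs. exact Hs. }
  apply (tot2_app (fun a n => nat_rect (fun _ => nat) (B a) (fun n r => St a n r) n));
    [|apply tot_id|assumption].
  exists (cRec b s). intros w. rewrite <- (cpair_unpair w) at 1. apply H.
Qed.

Lemma tot_match F G H :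
  tot F -> tot G -> tot2 H ->
  tot (fun x => match F x with 0 => G x | S k => H x k end).
Proof.
  intros HF HG HH.
  apply (tot_ext (fun x => nat_rect (fun _ => nat) (G x) (fun n _ => H x n) (F x))).
  - intros x. now destruct (F x).
  - apply (tot_rec G (fun x n _ => H x n)); try assumption.
    apply (tot2_app H); [assumption| |]; repeat (apply tot_fst || apply tot_snd); apply tot_id.
Qed.

Lemma tot_add F G : tot F -> tot G -> tot (fun x => F x + G x).
Proof.
  intros HF HG.
  apply (tot_ext (fun x => nat_rect (fun _ => nat) (G x) (fun _ r => S r) (F x))).
  - intros x. induction (F x); cbn; congruence.
  - apply (tot_rec G (fun _ _ r => S r)); try assumption.
    apply tot_S, tot_snd, tot_snd, tot_id.
Qed.

Lemma tot_mul F G : tot F -> tot G -> tot (fun x => F x * G x).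
Proof.
  intros HF HG.
  apply (tot_ext (fun x => nat_rect (fun _ => nat) 0 (fun _ r => G x + r) (F x))).
  - intros x. induction (F x); cbn; congruence.
  - apply (tot_rec (fun _ => 0) (fun x _ r => G x + r)); [apply tot_const| |assumption].
    apply tot_add; [apply (tot_comp G); [assumption|]; apply tot_fst, tot_id|].
    apply tot_snd, tot_snd, tot_id.
Qed.

Lemma tot_pred F : tot F -> tot (fun x => pred (F x)).
Proof.
  intros HF. apply (tot_ext (fun x => match F x with 0 => 0 | S k => k end)).
  { intros x. now destruct (F x). }
  apply (tot_match F (fun _ => 0) (fun _ k => k)); [assumption|apply tot_const|].
  apply tot_snd, tot_id.
Qed.

Lemma tot_sub F G : tot F -> tot G -> tot (fun x => F x - G x).
Proof.
  intros HF HG.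
  apply (tot_ext (fun x => nat_rect (fun _ => nat) (F x) (fun _ r => pred r) (G x))).
  - intros x. induction (G x); cbn; lia.
  - apply (tot_rec F (fun _ _ r => pred r)); try assumption.
    apply tot_pred, tot_snd, tot_snd, tot_id.
Qed.

Lemma tot_pow2 F : tot F -> tot (fun x => 2 ^ F x).
Proof.
  intros HF.
  apply (tot_ext (fun x => nat_rect (fun _ => nat) 1 (fun _ r => r + r) (F x))).
  - intros x. induction (F x); cbn; lia.
  - apply (tot_rec (fun _ => 1) (fun _ _ r => r + r)); [apply tot_const| |assumption].
    apply tot_add; apply tot_snd, tot_snd, tot_id.
Qed.

(** For total [f] every smaller argument has a value, so [cMu] is plain search for the least
    zero. *)
Lemma eval_cMu_tot f F :
  (forall x, eval A f x (F (fst (unpair x)) (snd (unpair x)))) ->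
  forall x n, eval A (cMu f) x n <-> F x n = 0 /\ forall m, m < n -> F x m <> 0.
Proof.
  intros Hf x n.
  assert (Hf' : forall m, eval A f (cpair x m) (F x m)).
  { intros m. specialize (Hf (cpair x m)). now rewrite unpair_cpair in Hf. }
  split.
  - intros H. apply eval_cMu in H as [H0 H1]. split.
    + apply (eval_det _ _ _ _ (Hf' n) H0).
    + intros m L E. destruct (H1 _ L) as [k Hk]. pose proof (eval_det _ _ _ _ (Hf' m) Hk). congruence.
  - intros [H0 H1]. constructor.
    + rewrite <- H0. apply Hf'.
    + intros m L. specialize (H1 m L). destruct (F x m) as [|k] eqn:E; [easy|].
      exists k. rewrite <- E. apply Hf'.
Qed.

Lemma tot_mu F G :
  tot2 F -> (forall x, F x (G x) = 0 /\ forall m, m < G x -> F x m <> 0) -> tot G.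
Proof. intros [f Hf] HG. exists (cMu f). intros x. now apply (eval_cMu_tot f F). Qed.

Lemma tot_log2 F : tot F -> tot (fun x => Nat.log2 (S (F x))).
Proof.
  apply (tot_comp (fun x => Nat.log2 (S x))).
  (* The difference vanishes exactly when [S x < 2 ^ S k]; the least such [k] is the logarithm of
     [S x]. *)
  apply (tot_mu (fun x k => S (S x) - 2 ^ S k)).
  - apply tot_sub; [|apply tot_pow2]; repeat apply tot_S; [apply tot_fst|apply tot_snd]; apply tot_id.
  - intros x. destruct (Nat.log2_spec (S x) ltac:(lia)) as [L1 L2]. split; [lia|].
    intros m Hm. pose proof (Nat.pow_le_mono_r 2 (S m) (Nat.log2 (S x)) ltac:(lia) ltac:(lia)). lia.
Qed.

(** With equality expressed by a vanishing number, conjunctions of equations become sums whose zeros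
    [cMu] can search for. *)
Definition dist (x y : nat) : nat := (x - y) + (y - x).

Lemma dist_0 x y : dist x y = 0 -> x = y.
Proof. unfold dist. lia. Qed.

Lemma dist_diag x : dist x x = 0.
Proof. unfold dist. lia. Qed.

Lemma tot_dist F G : tot F -> tot G -> tot (fun x => dist (F x) (G x)).
Proof. intros HF HG. apply tot_add; now apply tot_sub. Qed.

End Evaluation.

(** Recursions and case distinctions are left to explicit [refine] calls, where the step function is
    supplied by hand. *)
Ltac tot_step :=
  match goal with
  | |- tot2 _ _ => unfold tot2; cbn beta
  | |- tot _ (fun x => x) => apply tot_id
  | |- tot _ (fun _ => ?k) => apply tot_const
  | |- tot _ (fun x => S _) => apply tot_S
  | |- tot _ (fun x => _ + _) => apply tot_add
  | |- tot _ (fun x => _ * _) => apply tot_mul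
  | |- tot _ (fun x => _ - _) => apply tot_sub
  | |- tot _ (fun x => pred _) => apply tot_pred
  | |- tot _ (fun x => dist _ _) => apply tot_dist
  | |- tot _ (fun x => cpair _ _) => apply tot_pair
  | |- tot _ (fun x => fst (unpair _)) => apply tot_fst
  | |- tot _ (fun x => snd (unpair _)) => apply tot_snd
  | |- tot _ (fun x => 2 ^ _) => apply tot_pow2
  | |- tot _ (fun x => Nat.log2 (S _)) => apply tot_log2
  | H : tot ?A ?F |- tot ?A ?F => exact H
  | H : tot2 _ ?F |- tot _ (fun x => ?F _ _) => apply (tot2_app _ F); [exact H| |]
  | H : tot _ ?F |- tot _ (fun x => ?F _) => apply (tot_comp _ F); [exact H|]
  end.

Ltac solve_tot := repeat tot_step.

(** * Evaluation with bounded resources *)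

(* The state is 0 while searching, 1 once [u] is undefined, [n + 2] once the zero [n] is found;
   values of [u] are shifted by one, 0 standing for undefined. *)
Definition search (u : nat -> nat) : nat -> nat :=
  nat_rect (fun _ => nat) 0
    (fun n r => match r with
                | 0 => match u n with
                       | 0 => 1
                       | S k => match k with 0 => S (S n) | S _ => 0 end
                       end
                | S r' => S r'
                end).

(* Evaluation with fuel [s], without oracle: 0 means no value yet, [v + 1] means value [v]. *)
Fixpoint run (c : code) (x s : nat) : nat :=
  match c with
  | cZero => 1
  | cSucc => S (S x)
  | cId => S x
  | cFst => S (fst (unpair x))
  | cSnd => S (snd (unpair x))
  | cOrc => 1
  | cPair f g =>
      match run f x s with
      | 0 => 0
      | S y => match run g x s with 0 => 0 | S z => S (cpair y z) end
      end
  | cComp f g => match run g x s with 0 => 0 | S y => run f y s end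
  | cRec f g =>
      nat_rect (fun _ => nat) (run f (fst (unpair x)) s)
        (fun n r => match r with
                    | 0 => 0
                    | S z => run g (cpair (fst (unpair x)) (cpair n z)) s
                    end) (snd (unpair x))
  | cMu f =>
      pred (search (fun n => run f (cpair x n) s) s)
  end.

(** For each fixed [c], every clause of [run] is built from compositions, case distinctions and
    bounded recursions, even where [c] itself is partial. *)
Lemma tot_run A c : tot2 A (run c).
Proof.
  induction c as [| | | | | |f IHf g IHg|f IHf g IHg|f IHf g IHg|f IHf]; cbn [run]; unfold tot2.
  1-6: solve_tot.
  - refine (tot_match A (fun w => run f (fst (unpair w)) (snd (unpair w))) (fun _ => 0)
      (fun w y => match run g (fst (unpair w)) (snd (unpair w)) with 0 => 0 | S z => S (cpair y z) end) _ _ _);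
      solve_tot.
    refine (tot_match A (fun w => run g (fst (unpair (fst (unpair w)))) (snd (unpair (fst (unpair w))))) (fun _ => 0)
      (fun w z => S (cpair (snd (unpair w)) z)) _ _ _); solve_tot.
  - refine (tot_match A (fun w => run g (fst (unpair w)) (snd (unpair w))) (fun _ => 0)
      (fun w y => run f y (snd (unpair w))) _ _ _); solve_tot.
  - refine (tot_rec A (fun w => run f (fst (unpair (fst (unpair w)))) (snd (unpair w)))
      (fun w n r => match r with 0 => 0
         | S z => run g (cpair (fst (unpair (fst (unpair w)))) (cpair n z)) (snd (unpair w)) end)
      (fun w => snd (unpair (fst (unpair w)))) _ _ _); solve_tot.
    refine (tot_match A (fun w => snd (unpair (snd (unpair w)))) (fun _ => 0)
      (fun w z => run g (cpair (fst (unpair (fst (unpair (fst (unpair w))))))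
         (cpair (fst (unpair (snd (unpair w)))) z)) (snd (unpair (fst (unpair w))))) _ _ _); solve_tot.
  - apply tot_pred. unfold search.
    refine (tot_rec A (fun w => 0)
      (fun w n r => match r with
          | 0 => match run f (cpair (fst (unpair w)) n) (snd (unpair w)) with
                 | 0 => 1
                 | S k => match k with 0 => S (S n) | S _ => 0 end
                 end
          | S r' => S r'
          end)
      (fun w => snd (unpair w)) _ _ _); solve_tot.
    refine (tot_match A (fun w => snd (unpair (snd (unpair w))))
      (fun w => match run f (cpair (fst (unpair (fst (unpair w)))) (fst (unpair (snd (unpair w)))))
                  (snd (unpair (fst (unpair w)))) with
                 | 0 => 1
                 | S k => match k with 0 => S (S (fst (unpair (snd (unpair w))))) | S _ => 0 end
                 end)
      (fun _ r => S r) _ _ _); solve_tot.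
    refine (tot_match A (fun w => run f (cpair (fst (unpair (fst (unpair w)))) (fst (unpair (snd (unpair w)))))
                  (snd (unpair (fst (unpair w)))))
      (fun _ => 1)
      (fun w k => match k with 0 => S (S (fst (unpair (snd (unpair w))))) | S _ => 0 end) _ _ _); solve_tot.
    refine (tot_match A (fun w => snd (unpair w))
      (fun w => S (S (fst (unpair (snd (unpair (fst (unpair w))))))))
      (fun _ _ => 0) _ _ _); solve_tot.
Qed.

(** Values being shifted by one, [u n = 1] marks a zero at [n] and [S (S j)] a positive value. *)
Lemma search_spec u k :
  match search u k with
  | 0 => forall m, m < k -> exists j, u m = S (S j)
  | 1 => True
  | S (S n) => n < k /\ u n = 1 /\ forall m, m < n -> exists j, u m = S (S j)
  end.
Proof.
  induction k as [|k IH]; cbn; [lia|]. fold (search u k).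
  destruct (search u k) as [|[|n]].
  - destruct (u k) as [|[|j]] eqn:E; [exact I|repeat split; [lia|assumption..]|].
    intros m L. destruct (Nat.eq_dec m k) as [->|]; [eauto|]. apply IH; lia.
  - exact I.
  - intuition lia.
Qed.

Lemma search_found u k n :
  n < k -> u n = 1 -> (forall m, m < n -> exists j, u m = S (S j)) -> search u k = S (S n).
Proof.
  intros Hk Hn Hm.
  assert (H0 : search u n = 0).
  { clear Hk Hn. induction n as [|n IH]; [reflexivity|]. cbn. fold (search u n).
    rewrite IH by auto. destruct (Hm n ltac:(lia)) as [j ->]. reflexivity. }
  induction Hk as [|k Hk IH]; cbn.
  - fold (search u n). now rewrite H0, Hn.
  - fold (search u k). now rewrite IH.
Qed.

(** Under [cMu] the fuel bounds both the range of the search and the subcomputations; a zero once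
    found, and the positive values before it, survive an increase of either. This allows separate
    fuels to be merged by [max]. *)
Lemma run_mono c : forall x s s' v, run c x s = S v -> s <= s' -> run c x s' = S v.
Proof.
  induction c as [| | | | | |f IHf g IHg|f IHf g IHg|f IHf g IHg|f IHf];
    intros x s s' v H L; cbn [run] in *; try assumption.
  - destruct (run f x s) as [|y] eqn:Ef; [easy|]. destruct (run g x s) as [|z] eqn:Eg; [easy|].
    now rewrite (IHf _ _ _ _ Ef L), (IHg _ _ _ _ Eg L).
  - destruct (run g x s) as [|z] eqn:Eg; [easy|].
    rewrite (IHg _ _ _ _ Eg L). eauto.
  - revert v H. generalize (fst (unpair x)) as a. intros a.
    induction (snd (unpair x)) as [|n IH]; intros v; cbn [nat_rect]; [eauto|].
    match goal with |- match ?r with _ => _ end = _ -> _ => destruct r as [|z] eqn:E end; [easy|].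
    intros H. rewrite (IH _ eq_refl). eauto.
  - pose proof (search_spec (fun n => run f (cpair x n) s) s) as Sp.
    destruct (search (fun n => run f (cpair x n) s) s) as [|[|n]]; try easy.
    cbn in H. injection H as <-. destruct Sp as (L1 & Hn & Hm).
    rewrite (search_found _ s' n); [reflexivity|lia|eauto|].
    intros m Lm. destruct (Hm m Lm) as [j Hj]. eauto.
Qed.

(** The constant answer for [cOrc] is correct because [noOracle] is empty. *)
Lemma run_sound c : forall x s v, run c x s = S v -> eval noOracle c x v.
Proof.
  induction c as [| | | | | |f IHf g IHg|f IHf g IHg|f IHf g IHg|f IHf];
    intros x s v H; cbn [run] in H; try (injection H as <-; constructor; easy).
  - destruct (run f x s) as [|y] eqn:Ef; [easy|]. destruct (run g x s) as [|z] eqn:Eg; [easy|].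
    injection H as <-. constructor; eauto.
  - destruct (run g x s) as [|z] eqn:Eg; [easy|]. econstructor; eauto.
  - rewrite <- (cpair_unpair x). revert v H. generalize (fst (unpair x)) as a. intros a.
    induction (snd (unpair x)) as [|n IH]; intros v; cbn [nat_rect].
    + rewrite eval_cRec_0. eauto.
    + match goal with |- match ?r with _ => _ end = _ -> _ => destruct r as [|z] eqn:E end; [easy|].
      intros H. rewrite eval_cRec_S. eauto.
  - pose proof (search_spec (fun n => run f (cpair x n) s) s) as Sp.
    destruct (search (fun n => run f (cpair x n) s) s) as [|[|n]]; try easy.
    cbn in H. injection H as <-. destruct Sp as (L1 & Hn & Hm).
    apply eval_cMu; split; [eauto|].
    intros m Lm. destruct (Hm m Lm) as [j Hj]. eauto.
Qed.

Lemma run_complete c : forall x v, eval noOracle c x v -> exists s, run c x s = S v.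
Proof.
  induction c as [| | | | | |f IHf g IHg|f IHf g IHg|f IHf g IHg|f IHf]; intros x v H; cbn [run];
    try (exists 0; inversion H; subst; easy).
  - apply eval_cPair in H as (y & z & Hf & Hg & ->).
    apply IHf in Hf as [s1 Hf]. apply IHg in Hg as [s2 Hg]. exists (max s1 s2).
    now rewrite (run_mono _ _ _ _ _ Hf (Nat.le_max_l _ _)), (run_mono _ _ _ _ _ Hg (Nat.le_max_r _ _)).
  - apply eval_cComp in H as (y & Hg & Hf).
    apply IHf in Hf as [s1 Hf]. apply IHg in Hg as [s2 Hg]. exists (max s1 s2).
    rewrite (run_mono _ _ _ _ _ Hg (Nat.le_max_r _ _)). apply (run_mono _ _ _ _ _ Hf (Nat.le_max_l _ _)).
  - rewrite <- (cpair_unpair x) in H. revert v H. generalize (fst (unpair x)) as a. intros a.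
    induction (snd (unpair x)) as [|n IH]; intros v; cbn [nat_rect].
    + rewrite eval_cRec_0. eauto.
    + rewrite eval_cRec_S. intros (z & Hz & Hg).
      apply IH in Hz as [s1 Hz]. apply IHg in Hg as [s2 Hg]. exists (max s1 s2).
      pose proof (run_mono (cRec f g) (cpair a n) s1 (max s1 s2) z) as M. cbn [run] in M.
      rewrite fst_unpair_cpair, snd_unpair_cpair in M.
      rewrite (M Hz (Nat.le_max_l _ _)). apply (run_mono _ _ _ _ _ Hg (Nat.le_max_r _ _)).
  - apply eval_cMu in H as [H0 Hm]. apply IHf in H0 as [s0 H0].
    (* A common fuel for the finitely many positive values before the zero. *)
    assert (B : forall k, k <= v -> exists s, forall m, m < k -> exists j, run f (cpair x m) s = S (S j)).
    { induction k as [|k IH]; intros L; [exists 0; lia|].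
      destruct (IH ltac:(lia)) as [s1 H1]. destruct (Hm k L) as [j Hj]. apply IHf in Hj as [s2 H2].
      exists (max s1 s2). intros m Lm. destruct (Nat.eq_dec m k) as [->|].
      - exists j. apply (run_mono _ _ _ _ _ H2 (Nat.le_max_r _ _)).
      - destruct (H1 m ltac:(lia)) as [i Hi]. exists i. apply (run_mono _ _ _ _ _ Hi (Nat.le_max_l _ _)). }
    destruct (B v (le_n v)) as [s1 H1]. exists (max (S v) (max s0 s1)).
    rewrite (search_found _ _ v); [reflexivity|lia| |].
    + eapply run_mono; [eassumption|lia].
    + intros m Lm. destruct (H1 m Lm) as [j Hj]. exists j. eapply run_mono; [eassumption|lia].
Qed.

Lemma eval_run c x v : eval noOracle c x v <-> exists s, run c x s = S v.
Proof. split; [apply run_complete|intros [s H]; eapply run_sound; eassumption]. Qed.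

(** * Deciding existential statements with the halting set *)

Fixpoint idx (c : code) : nat :=
  match c with
  | cZero => cpair 0 0
  | cSucc => cpair 1 0
  | cId => cpair 2 0
  | cFst => cpair 3 0
  | cSnd => cpair 4 0
  | cOrc => cpair 5 0
  | cPair f g => cpair 6 (cpair (idx f) (idx g))
  | cComp f g => cpair 7 (cpair (idx f) (idx g))
  | cRec f g => cpair 8 (cpair (idx f) (idx g))
  | cMu f => cpair 9 (idx f)
  end.

(** By [cpair_ge] the positive tag makes an index exceed those of its components, so one unit of
    fuel per level suffices, and [decode] can take the number itself as fuel. *)
Lemma dec_idx c : forall fuel, idx c <= fuel -> dec fuel (idx c) = c.
Proof.
  induction c as [| | | | | |f IHf g IHg|f IHf g IHg|f IHf g IHg|f IHf]; intros fuel L.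
  1: now destruct fuel.
  1-5: cbn [idx] in L;
    match type of L with cpair ?a ?b <= _ => pose proof (cpair_ge a b) end;
    destruct fuel; [lia|]; cbn [dec idx]; now rewrite unpair_cpair.
  1-3: cbn [idx] in L;
    match type of L with cpair ?a ?b <= _ => pose proof (cpair_ge a b) end;
    pose proof (cpair_ge (idx f) (idx g));
    destruct fuel; [lia|]; cbn [dec idx]; rewrite !unpair_cpair, IHf, IHg by lia; reflexivity.
  cbn [idx] in L. pose proof (cpair_ge 9 (idx f)).
  destruct fuel; [lia|]; cbn [dec idx]; rewrite unpair_cpair, IHf by lia; reflexivity.
Qed.

Lemma decode_idx c : decode (idx c) = c.
Proof. now apply dec_idx. Qed.

Fixpoint const_code (k : nat) : code :=
  match k with 0 => cZero | S k => cComp cSucc (const_code k) end.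

Lemma eval_const_code A k x v : eval A (const_code k) x v <-> v = k.
Proof.
  revert v; induction k as [|k IH]; intros v; cbn [const_code].
  - split; [now inversion 1|intros ->; constructor].
  - rewrite eval_cComp. split.
    + intros (y & Hy & Hv). apply IH in Hy. inversion Hv; now subst.
    + intros ->. exists k. split; [now apply IH|constructor].
Qed.

(** The instance of the s-m-n theorem used below: the index of a program with a hard-wired argument
    is computable from that argument. *)
Lemma tot_idx_const A : tot A (fun x => idx (const_code x)).
Proof.
  apply (tot_ext _ (fun x => nat_rect (fun _ => nat) (idx cZero)
           (fun _ r => cpair 7 (cpair (idx cSucc) r)) x)).
  - intros x. induction x as [|x IH]; [reflexivity|]. cbn [nat_rect]. now rewrite IH.
  - apply (tot_rec _ (fun _ => idx cZero) (fun _ _ r => cpair 7 (cpair (idx cSucc) r)) (fun x => x));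
      solve_tot.
Qed.

Definition decide (P : Prop) : nat := if excluded_middle_informative P then 1 else 0.

Lemma decide_true P : P -> decide P = 1.
Proof. unfold decide. now destruct (excluded_middle_informative P). Qed.

Lemma decide_false P : ~ P -> decide P = 0.
Proof. unfold decide. now destruct (excluded_middle_informative P). Qed.

(* [x] is mapped to the index of a program that ignores its input and searches for [y]. *)
Lemma tot_Halt_exists F :
  tot2 noOracle F -> tot Halt (fun x => decide (exists y, F x y = 0)).
Proof.
  intros [r Hr].
  set (h := fun x => idx (cComp (cMu r) (const_code x))).
  assert (Th : tot Halt h).
  { unfold h. cbn [idx]. pose proof (tot_idx_const Halt). solve_tot. }
  assert (HH : forall x, Halt (h x) <-> exists y, F x y = 0).
  { intros x. unfold Halt, h. rewrite decode_idx. split.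
    - intros [v H]. apply eval_cComp in H as (y & Hy & Hv). apply eval_const_code in Hy as ->.
      apply (eval_cMu_tot _ r F Hr) in Hv as [Hv _]. eauto.
    - intros Hx. apply nat_least in Hx as (n & Hn & Hm). exists n.
      apply eval_cComp. exists x. split; [now apply eval_const_code|].
      now apply (eval_cMu_tot _ r F Hr). }
  destruct Th as [c Hc]. exists (cComp cOrc c). intros x. econstructor; [apply Hc|].
  destruct (excluded_middle_informative (exists y, F x y = 0)) as [E|E].
  - rewrite decide_true by assumption. constructor. now apply HH.
  - rewrite decide_false by assumption. constructor. now rewrite HH.
Qed.

(** * Self-delimiting strings *)

(** [enc] is bijective base two with digits 1 and 2, least significant first, so a prefix shifts the
    rest by its length. *)
Lemma enc_app p q : enc (p ++ q) = enc p + 2 ^ length p * enc q.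
Proof.
  induction p as [|b p IH]; cbn [app enc length]; [cbn; lia|].
  rewrite IH, Nat.pow_succ_r'. lia.
Qed.

Lemma enc_inj p q : enc p = enc q -> p = q.
Proof.
  revert q; induction p as [|b p IH]; intros [|b' q]; cbn [enc]; intros E;
    [reflexivity|discriminate..|].
  assert (b = b') as <- by (destruct b, b'; lia).
  f_equal. apply IH. lia.
Qed.

(** The strings of length [k] have the codes from [2 ^ k - 1] to [2 ^ (k + 1) - 2]. *)
Lemma length_enc p : length p = Nat.log2 (S (enc p)).
Proof.
  symmetry. apply Nat.log2_unique; [lia|].
  induction p as [|b p [IH1 IH2]]; [cbn; lia|].
  cbn [length enc]. rewrite (Nat.pow_succ_r' 2 (S _)), Nat.pow_succ_r' in *. destruct b; lia.
Qed.

(** Adding one in this numeration, [false] being the digit 1 and [true] the digit 2; the digit 2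
    passes on a carry. *)
Fixpoint incr (s : list bool) : list bool :=
  match s with
  | [] => [false]
  | false :: s' => true :: s'
  | true :: s' => false :: incr s'
  end.

Definition bits (n : nat) : list bool := Nat.iter n incr [].

Lemma enc_bits n : enc (bits n) = n.
Proof.
  assert (H : forall s, enc (incr s) = S (enc s)).
  { induction s as [|[] s IH]; cbn [incr enc]; lia. }
  induction n as [|n IH]; [reflexivity|].
  change (bits (S n)) with (incr (bits n)). now rewrite H, IH.
Qed.

Lemma bits_enc p : bits (enc p) = p.
Proof. apply enc_inj, enc_bits. Qed.

Lemma length_bits n : length (bits n) = Nat.log2 (S n).
Proof. now rewrite length_enc, enc_bits. Qed.

(** A prefix-free code: the unary block announces the size of the length field, which in turn
    announces the length of [p]. *)
Definition delim (p : list bool) : list bool :=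
  repeat true (length (bits (length p))) ++ false :: bits (length p) ++ p.

Lemma app_inj_length (T : Type) (p p' q q' : list T) :
  length p = length p' -> p ++ q = p' ++ q' -> p = p' /\ q = q'.
Proof.
  revert p'; induction p as [|x p IH]; intros [|x' p'] L E; try discriminate; [easy|].
  cbn in *. injection L as L. injection E as <- E. destruct (IH _ L E). now subst.
Qed.

(** Parsing from the left: the first [false] ends the unary block and so fixes the size of the
    length field; the length read there tells where [p] ends. *)
Lemma delim_inj p p' q q' : delim p ++ q = delim p' ++ q' -> p = p' /\ q = q'.
Proof.
  unfold delim. rewrite <- !app_assoc. cbn [app]. rewrite <- !app_assoc. intros E.
  assert (U : forall k k' (l l' : list bool),
    repeat true k ++ false :: l = repeat true k' ++ false :: l' -> k = k' /\ l = l').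
  { induction k as [|k IH]; intros [|k'] l l'; cbn; intros H; try discriminate; injection H as H.
    - easy.
    - apply IH in H as [-> ->]. easy. }
  apply U in E as [E1 E2]. apply app_inj_length in E2 as [E2 E3]; [|assumption].
  apply (f_equal enc) in E2. rewrite !enc_bits in E2.
  now apply app_inj_length.
Qed.

(** The length field is paid for twice, once in unary; each copy costs at most
    [Nat.log2 (length p) + 1], and the separator costs 1. *)
Lemma length_delim p : length (delim p) <= length p + 2 * Nat.log2 (length p) + 3.
Proof.
  unfold delim. rewrite length_app, repeat_length. cbn [length]. rewrite length_app, length_bits.
  pose proof (Nat.log2_succ_le (length p)). lia.
Qed.

(** Concatenation transported to codes, so that its computability can be expressed by [tot];
    [ndelim] does the same for [delim]. *)
Definition ncat (x y : nat) : nat := x + 2 ^ Nat.log2 (S x) * y.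

Lemma ncat_enc p q : ncat (enc p) (enc q) = enc (p ++ q).
Proof. unfold ncat. now rewrite enc_app, <- length_enc. Qed.

Definition nunary (k : nat) : nat := nat_rect (fun _ => nat) 1 (fun _ r => S (2 * r + 1)) k.

Definition ndelim (x : nat) : nat :=
  ncat (nunary (Nat.log2 (S (Nat.log2 (S x))))) (ncat (Nat.log2 (S x)) x).

Lemma ndelim_enc p : ndelim (enc p) = enc (delim p).
Proof.
  unfold ndelim, delim. rewrite <- length_enc, <- length_bits.
  set (k := length (bits (length p))).
  replace (nunary k) with (enc (repeat true k ++ [false])).
  (* The length is its own code for the length field, as [enc] inverts [bits]. *)
  - rewrite <- (enc_bits (length p)) at 1. rewrite !ncat_enc, <- app_assoc. reflexivity.
  - induction k as [|k IH]; [reflexivity|]. cbn [repeat app enc nunary nat_rect]. now rewrite IH.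
Qed.

Lemma tot_ncat A F G : tot A F -> tot A G -> tot A (fun x => ncat (F x) (G x)).
Proof. intros. unfold ncat. solve_tot. Qed.

Lemma tot_ndelim A F : tot A F -> tot A (fun x => ndelim (F x)).
Proof.
  intros HF. unfold ndelim. apply tot_ncat; [|apply tot_ncat; solve_tot].
  unfold nunary.
  apply (tot_rec A (fun _ => 1) (fun _ _ r => S (2 * r + 1))); solve_tot.
Qed.

(** * Complexities *)

Lemma isK_unique {D : Type} (phi : pfun D) d m n : isK phi d m -> isK phi d n -> m = n.
Proof. intros [(p & Hp & <-) Hm] [(q & Hq & <-) Hn]. apply Nat.le_antisymm; auto. Qed.

(** [optimal] compares shortest programs only; a shortest program for [theta] is no longer than the
    given [p], so the bound extends to every program. *)
Lemma optimal_bound {D : Type} (C : pfun D -> Prop) phi theta (K : D -> nat) :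
  optimal C phi -> C theta -> (forall d, isK phi d (K d)) ->
  exists c, forall p d, theta p d -> K d <= length p + c.
Proof.
  intros [_ Ho] Ht HK. destruct (Ho theta Ht) as [c Hc]. exists c. intros p d Hp.
  destruct (nat_least (fun n => exists q, theta q d /\ length q = n)) as (n & Hn & Hm); [eauto|].
  assert (Hp' : n <= length p).
  { destruct (le_lt_dec n (length p)) as [|L]; [assumption|]. destruct (Hm _ L); eauto. }
  destruct (Hc d n) as (m & Hm1 & Hm2).
  - split; [assumption|]. intros q Hq.
    destruct (le_lt_dec n (length q)) as [|L]; [assumption|]. destruct (Hm _ L); eauto.
  - rewrite (isK_unique _ _ _ _ (HK d) Hm1). lia.
Qed.

Section Poset.
Context {D : Type} (rho : nat -> D).
Hypothesis Hrho : bijective_nat rho.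

Lemma rho_inj m n : rho m = rho n -> m = n.
Proof. apply Hrho. Qed.

Lemma PC_code A c : PC A rho (fun p d => exists n, rho n = d /\ eval A c (enc p) n).
Proof.
  exists c. intros p n. split; [eauto|]. intros (m & E & H). apply rho_inj in E. now subst.
Qed.

Lemma PC_fun A phi p d e : PC A rho phi -> phi p d -> phi p e -> d = e.
Proof.
  intros [c Hc] Hd He.
  destruct (proj2 Hrho d) as [m <-], (proj2 Hrho e) as [n <-].
  apply Hc in Hd, He. f_equal. eapply eval_det; eassumption.
Qed.

(** * Maxima of monotone approximations *)

Section Order.
Variable lt : D -> D -> Prop.
Hypothesis lt_irrefl : forall x, ~ lt x x.
Hypothesis lt_trans : forall x y z, lt x y -> lt y z -> lt x z.

(** A partial computable function is the maximum of an approximation that does not depend on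
    time. *)
Lemma PC_MaxPR phi : PC noOracle rho phi -> MaxPR lt rho phi.
Proof.
  intros HP. pose proof (PC_fun noOracle phi) as F. destruct HP as [c Hc].
  exists (fun p _ d => phi p d). split; [|split].
  - exists (cComp c cFst). intros p t n. rewrite <- Hc, eval_cComp. split.
    + intros (y & Hy & H). inversion Hy; subst. now rewrite fst_unpair_cpair in H.
    + intros H. exists (enc p). split; [|assumption].
      pose proof (eFst noOracle (cpair (enc p) t)) as E. now rewrite fst_unpair_cpair in E.
  - intros p t1 t2 e1 e2 _ H1 H2. left. eapply F; [exists c|..]; eassumption.
  - intros p d. split.
    + intros H.
      assert (Hu : forall e, phi p e -> e = d) by (intros e He; eapply F; [exists c|..]; eassumption).
      split; [exists 0; assumption|split].
      * exists [d]. intros _ e He. left. symmetry; auto.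
      * intros _ e He. left. auto.
    + intros ((t & H) & _). exact H.
Qed.

(** If [d] is left after being reached, monotonicity gives a strictly larger value. Conversely, if
    [d] is never left after [t], other values occur only at the finitely many earlier times, and
    they lie below [d]. *)
Lemma maxrel_iff (f : list bool -> nat -> D -> Prop) p d :
  (forall t e1 e2, f p t e1 -> f p t e2 -> e1 = e2) ->
  (forall t1 t2 e1 e2, t1 <= t2 -> f p t1 e1 -> f p t2 e2 -> e1 = e2 \/ lt e1 e2) ->
  maxrel lt f p d <->
  (exists t, f p t d) /\
  ~ exists t t' e, t <= t' /\ f p t d /\ f p t' e /\ e <> d.
Proof.
  intros Hf Hm. split.
  - intros (H1 & _ & H3). split; [assumption|].
    intros (t & t' & e & L & Ht & Ht' & Ne).
    destruct (Hm _ _ _ _ L Ht Ht') as [<-|L1]; [easy|].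
    destruct (H3 _ _ Ht') as [->|L2]; [easy|]. eapply lt_irrefl, lt_trans; eassumption.
  - intros [[t Ht] HN].
    assert (Hs : forall t' e, t <= t' -> f p t' e -> e = d).
    { intros t' e L He. apply NNPP. intros Ne. apply HN. eauto 7. }
    split; [eauto|split].
    + assert (B : forall k, exists l, forall t' e, t' < k -> f p t' e -> In e l).
      { induction k as [|k [l IH]]; [exists []; lia|].
        destruct (classic (exists e, f p k e)) as [[e He]|N].
        - exists (e :: l). intros t' e' L He'.
          destruct (Nat.eq_dec t' k) as [->|]; [left; eauto|right; apply (IH t'); [lia|assumption]].
        - exists l. intros t' e' L He'.
          destruct (Nat.eq_dec t' k) as [->|]; [destruct N; eauto|apply (IH t'); [lia|assumption]]. }
      destruct (B t) as [l Hl]. exists (d :: l). intros t' e He.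
      destruct (le_lt_dec t t') as [L|L]; [left; symmetry; eauto|right; eauto].
    + intros t' e He. destruct (le_lt_dec t t') as [L|L]; [left; eauto|].
      apply (Hm t' t); [lia|assumption..].
Qed.

Lemma MaxPR_fun U p d e : MaxPR lt rho U -> U p d -> U p e -> d = e.
Proof.
  intros (f & _ & _ & HU) Hd He. apply HU in Hd, He.
  destruct Hd as ((t & Ht) & _ & Hd), He as ((t' & Ht') & _ & He).
  destruct (He _ _ Ht) as [|L]; [assumption|]. destruct (Hd _ _ Ht') as [|L']; [easy|].
  destruct (lt_irrefl d). eauto.
Qed.

Definition graph (U : pfun D) (x n : nat) : nat := decide (U (bits x) (rho n)).

(* [d] is the maximum iff it is reached (Sigma_1) and never left afterwards (Pi_1):
   unlike that of an arbitrary function computable in the halting set, this graph is decidable in it. *)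
Lemma tot_graph U : MaxPR lt rho U -> tot2 Halt (graph U).
Proof.
  intros (f & (c & Hc) & Hm & HU).
  (* Here [i] codes a program and a value [n]; a zero [w] codes a time and a fuel at which [n] is
     returned. *)
  set (F1 := fun i w =>
    dist (run c (cpair (fst (unpair i)) (fst (unpair w))) (snd (unpair w))) (S (snd (unpair i)))).
  (* A zero codes two times with fuels; the summands demand the value [n] at the first time, the
     order of the times, a value at the second time, and its difference from [n]. *)
  set (F2 := fun i w => F1 i (fst (unpair w))
    + (fst (unpair (fst (unpair w))) - fst (unpair (snd (unpair w))))
    + (1 - run c (cpair (fst (unpair i)) (fst (unpair (snd (unpair w))))) (snd (unpair (snd (unpair w)))))
    + (1 - F1 i (snd (unpair w)))).
  pose proof (tot_run noOracle c) as Tc.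
  assert (T1 : tot2 noOracle F1) by (unfold F1; solve_tot).
  assert (T2 : tot2 noOracle F2) by (unfold F2; solve_tot).
  apply tot_Halt_exists in T1, T2.
  (* Truncated subtraction yields 1 exactly when the first statement holds and the second fails. *)
  apply (tot_ext _ (fun i => decide (exists y, F1 i y = 0) - decide (exists y, F2 i y = 0)));
    [|solve_tot; apply (tot_comp Halt (fun i => decide _)); solve_tot; assumption].
  intros i. set (x := fst (unpair i)). set (n := snd (unpair i)). unfold graph.
  assert (HF : forall t e, f (bits x) t (rho e) <-> exists s, run c (cpair x t) s = S e).
  { intros t e. rewrite <- Hc, eval_run, enc_bits. reflexivity. }
  assert (E1 : (exists y, F1 i y = 0) <-> exists t, f (bits x) t (rho n)).
  { unfold F1. fold x n. split.
    - intros [w Hw]. apply dist_0 in Hw. exists (fst (unpair w)). apply HF.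
      exists (snd (unpair w)). exact Hw.
    - intros [t Ht]. apply HF in Ht as [s Hs]. exists (cpair t s).
      rewrite fst_unpair_cpair, snd_unpair_cpair, Hs. apply dist_diag. }
  assert (E2 : (exists y, F2 i y = 0) <->
    exists t t' e, t <= t' /\ f (bits x) t (rho n) /\ f (bits x) t' e /\ e <> rho n).
  { unfold F2, F1. fold x n. split.
    - intros [w Hw].
      destruct (run c (cpair x (fst (unpair (snd (unpair w))))) (snd (unpair (snd (unpair w)))))
        as [|e] eqn:Ee; [lia|].
      exists (fst (unpair (fst (unpair w)))), (fst (unpair (snd (unpair w)))), (rho e).
      split; [lia|split; [|split]].
      + apply HF. exists (snd (unpair (fst (unpair w)))). apply dist_0. lia.
      + apply HF. eauto.
      + intros E. apply rho_inj in E. subst e. pose proof (dist_diag (S n)). lia.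
    - intros (t & t' & d & L & Ht & Hd & Ne). destruct (proj2 Hrho d) as [e <-].
      apply HF in Ht as [s Hs], Hd as [s' Hs'].
      exists (cpair (cpair t s) (cpair t' s')).
      repeat rewrite ?fst_unpair_cpair, ?snd_unpair_cpair. rewrite Hs, Hs'.
      rewrite dist_diag.
      assert (dist (S e) (S n) <> 0) by (intros E; apply dist_0 in E; congruence). lia. }
  assert (E : U (bits x) (rho n) <-> (exists y, F1 i y = 0) /\ ~ (exists y, F2 i y = 0)).
  { rewrite HU, E1, E2. apply maxrel_iff.
    - intros t d1 d2. destruct (proj2 Hrho d1) as [m1 <-], (proj2 Hrho d2) as [m2 <-].
      rewrite <- !Hc. intros H1 H2. f_equal. eapply eval_det; eassumption.
    - intros *. apply Hm. }
  unfold decide.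
  destruct (excluded_middle_informative (exists y, F1 i y = 0)),
    (excluded_middle_informative (exists y, F2 i y = 0)),
    (excluded_middle_informative (U (bits x) (rho n))); tauto.
Qed.

(** The halting set decides the graph, so the value is found by search; single-valuedness makes the
    first hit the only one. *)
Lemma MaxPR_PC_Halt U : MaxPR lt rho U -> PC Halt rho U.
Proof.
  intros HU. pose proof (tot_graph U HU) as T.
  assert (T' : tot2 Halt (fun x n => 1 - graph U x n)) by solve_tot.
  destruct T' as [r Hr]. exists (cMu r). intros p n.
  rewrite (eval_cMu_tot Halt r (fun x n => 1 - graph U x n) Hr).
  assert (G : forall m, 1 - graph U (enc p) m = 0 <-> U p (rho m)).
  { intros m. unfold graph. rewrite bits_enc. destruct (classic (U p (rho m))) as [H|H].
    - rewrite decide_true by assumption. tauto.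
    - rewrite decide_false by assumption. easy. }
  rewrite G. split; [tauto|]. intros H. split; [assumption|].
  intros m L E. apply G in E. pose proof (rho_inj _ _ (MaxPR_fun U p _ _ HU H E)). lia.
Qed.

(** Each of the finitely many programs has at most one value. This makes the search in [Halt_avoid]
    succeed. *)
Lemma graph_bounded U M : MaxPR lt rho U -> exists B, forall x n, x < M -> graph U x n <> 0 -> n < B.
Proof.
  intros HU.
  assert (G : forall x n, graph U x n <> 0 -> U (bits x) (rho n)).
  { intros x n H. apply NNPP. intros N. apply H. now apply decide_false. }
  induction M as [|M [B IH]]; [exists 0; lia|].
  destruct (classic (exists n, graph U M n <> 0)) as [[k Hk]|N].
  - exists (max B (S k)). intros x n L H. destruct (Nat.eq_dec x M) as [->|].
    + apply G in Hk, H. pose proof (rho_inj _ _ (MaxPR_fun U _ _ _ HU Hk H)). lia.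
    + pose proof (IH x n ltac:(lia) H). lia.
  - exists B. intros x n L H. destruct (Nat.eq_dec x M) as [->|]; [destruct N; eauto|].
    apply (IH x n); [lia|assumption].
Qed.

End Order.

(* Both approximations sandwich [d], so a value common to them must be [d]. *)
Lemma K_le_delim (lt : D -> D -> Prop) phi U V (K : D -> nat) :
  (forall x, ~ lt x x) -> (forall x y z, lt x y -> lt y z -> lt x z) ->
  optimal (PC noOracle rho) phi -> (forall d, isK phi d (K d)) ->
  MaxPR lt rho U -> MaxPR (fun x y => lt y x) rho V ->
  exists c, forall p q d, U p d -> V q d ->
    K d <= length p + 2 * Nat.log2 (length p) + length q + c.
Proof.
  intros Hi Ht Ho HK (f & (cf & Hf) & _ & HU) (g & (cg & Hg) & _ & HV).
  (* The number [w] codes [((p, q), ((t, s), (t', s')))]: both programs, each with a time and a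
     fuel. *)
  set (a := fun w => run cf (cpair (fst (unpair (fst (unpair w)))) (fst (unpair (fst (unpair (snd (unpair w)))))))
                       (snd (unpair (fst (unpair (snd (unpair w))))))).
  set (b := fun w => run cg (cpair (snd (unpair (fst (unpair w)))) (fst (unpair (snd (unpair (snd (unpair w)))))))
                       (snd (unpair (snd (unpair (snd (unpair w))))))).
  (* A zero means that the input [z] is [delim p ++ q] and that both runs return the same value; the
     search itself thus parses the input. *)
  set (F := fun z w => dist (ncat (ndelim (fst (unpair (fst (unpair w))))) (snd (unpair (fst (unpair w))))) z
              + dist (a w) (b w) + (1 - a w)).
  pose proof (tot_run noOracle cf) as Tcf. pose proof (tot_run noOracle cg) as Tcg.
  assert (Ta : tot noOracle a) by (unfold a; solve_tot).
  assert (Tb : tot noOracle b) by (unfold b; solve_tot).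
  assert (TF : tot2 noOracle F).
  { unfold F. solve_tot. apply tot_ncat; [apply tot_ndelim|]; solve_tot. }
  assert (To : tot noOracle (fun w => pred (a w))) by solve_tot.
  destruct TF as [r Hr], To as [o Hout].
  destruct (optimal_bound _ _ _ _ Ho (PC_code noOracle (cComp o (cMu r))) HK) as [c Hc].
  exists (3 + c). intros p q d HUp HVq.
  enough (Hz : exists n, rho n = d /\ eval noOracle (cComp o (cMu r)) (enc (delim p ++ q)) n).
  { apply Hc in Hz. rewrite length_app in Hz. pose proof (length_delim p). lia. }
  apply HU in HUp as ((t & Hfd) & _ & Hfm). apply HV in HVq as ((t' & Hgd) & _ & Hgm).
  destruct (proj2 Hrho d) as [n <-]. exists n. split; [reflexivity|].
  destruct (nat_least (fun w => F (enc (delim p ++ q)) w = 0)) as (w & Hw & Hl).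
  - apply Hf, eval_run in Hfd as [s Hs]. apply Hg, eval_run in Hgd as [s' Hs'].
    exists (cpair (cpair (enc p) (enc q)) (cpair (cpair t s) (cpair t' s'))).
    unfold F, a, b. repeat rewrite ?fst_unpair_cpair, ?snd_unpair_cpair.
    rewrite ndelim_enc, ncat_enc, Hs, Hs', !dist_diag. reflexivity.
  - apply eval_cComp. exists w. split; [now apply (eval_cMu_tot _ r F Hr)|].
    (* The least zero may differ from the one exhibited, so the value is identified from the
       vanishing of [F] alone. *)
    replace n with (pred (a w)); [apply Hout|].
    unfold F in Hw.
    assert (E1 : dist (ncat (ndelim (fst (unpair (fst (unpair w))))) (snd (unpair (fst (unpair w)))))
                  (enc (delim p ++ q)) = 0) by lia.
    assert (E2 : dist (a w) (b w) = 0) by lia.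
    apply dist_0 in E1, E2. destruct (a w) as [|m] eqn:Ea; [lia|]. clear Hw.
    rewrite <- (enc_bits (fst (unpair (fst (unpair w))))), <- (enc_bits (snd (unpair (fst (unpair w))))) in E1.
    rewrite ndelim_enc, ncat_enc in E1. apply enc_inj, delim_inj in E1 as [<- <-].
    apply run_sound in Ea. symmetry in E2. apply run_sound in E2.
    rewrite <- (enc_bits (fst (unpair (fst (unpair w))))) in Ea.
    rewrite <- (enc_bits (snd (unpair (fst (unpair w))))) in E2.
    apply Hf in Ea. apply Hg in E2. cbn [pred]. apply rho_inj.
    destruct (Hfm _ _ Ea) as [|L1]; [assumption|]. destruct (Hgm _ _ E2) as [|L2]; [assumption|].
    destruct (Hi (rho m)). eauto.
Qed.

(* [rho n], for [n] least avoiding the first (N + 1)^2 programs of both [U] and [V], is computed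
   in the halting set from the string [bits N], of half the length of these programs. *)
Lemma Halt_avoid (lt : D -> D -> Prop) U V :
  (forall x, ~ lt x x) -> (forall x y z, lt x y -> lt y z -> lt x z) ->
  MaxPR lt rho U -> MaxPR (fun x y => lt y x) rho V ->
  exists theta, PC Halt rho theta /\
    forall N, exists d, theta (bits N) d /\
      forall p, U p d \/ V p d -> 2 * Nat.log2 (S N) <= length p.
Proof.
  intros Hi Ht HU HV.
  assert (Ht' : forall x y z, lt y x -> lt z y -> lt z x) by eauto.
  pose proof (tot_graph lt Hi Ht U HU) as TU.
  pose proof (tot_graph (fun x y => lt y x) Hi Ht' V HV) as TV.
  (* The sum counts the descriptions of [rho n] among the programs with code below [(N + 1)^2], for
     [U] and [V] together. *)
  set (F := fun N n => nat_rect (fun _ => nat) 0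
     (fun x r => r + (graph U x n + graph V x n)) (S N * S N)).
  assert (TF : tot2 Halt F).
  { apply (tot_rec Halt (fun _ => 0)
      (fun w x r => r + (graph U x (snd (unpair w)) + graph V x (snd (unpair w))))); solve_tot. }
  destruct TF as [r Hr].
  exists (fun p d => exists n, rho n = d /\ eval Halt (cMu r) (enc p) n).
  split; [apply PC_code|]. intros N.
  assert (E : forall M n, nat_rect (fun _ => nat) 0
     (fun x r => r + (graph U x n + graph V x n)) M = 0 <->
     forall x, x < M -> graph U x n = 0 /\ graph V x n = 0).
  { intros M n. induction M as [|M IH]; cbn [nat_rect]; [split; [lia|reflexivity]|].
    split.
    - intros H x L. destruct (Nat.eq_dec x M) as [->|]; [lia|]. apply IH; lia.
    - intros H. rewrite (proj2 IH) by auto. destruct (H M); lia. }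
  destruct (nat_least (fun n => F N n = 0)) as (n & Hn & Hm).
  { destruct (graph_bounded lt Hi Ht U (S N * S N) HU) as [B1 H1].
    destruct (graph_bounded (fun x y => lt y x) Hi Ht' V (S N * S N) HV) as [B2 H2].
    exists (max B1 B2). apply E. intros x L. split.
    - specialize (H1 x (max B1 B2) L). lia.
    - specialize (H2 x (max B1 B2) L). lia. }
  exists (rho n). split.
  - exists n. split; [reflexivity|]. rewrite enc_bits. now apply (eval_cMu_tot _ r F Hr).
  - intros p Hp. pose proof (proj1 (E _ _) Hn) as Hz.
    destruct (le_lt_dec (S N * S N) (enc p)) as [L|L].
    + rewrite length_enc. destruct (Nat.log2_spec (S N) ltac:(lia)) as [P _].
      apply Nat.log2_le_pow2; [lia|].
      replace (2 * Nat.log2 (S N)) with (Nat.log2 (S N) + Nat.log2 (S N)) by lia.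
      rewrite Nat.pow_add_r. nia.
    + destruct (Hz _ L) as [Z1 Z2]. unfold graph in Z1, Z2. rewrite bits_enc in Z1, Z2.
      destruct Hp as [Hp|Hp]; rewrite decide_true in * by assumption; discriminate.
Qed.

End Poset.

(** * Comparison of the complexities up to an additive constant *)

Theorem mainTheorem1 (D : Type) (lt : D -> D -> Prop) (rho : nat -> D)
  (HD : computable_poset lt rho)
  (phi U V psi : pfun D)
  (Hphi : optimal (PC noOracle rho) phi)
  (HU : optimal (MaxPR lt rho) U)
  (HV : optimal (MaxPR (fun x y => lt y x) rho) V)
  (Hpsi : optimal (PC Halt rho) psi)
  (KD Kmax Kmin K0 : D -> nat)
  (HKD : forall d, isK phi d (KD d))
  (HKmax : forall d, isK U d (Kmax d))
  (HKmin : forall d, isK V d (Kmin d))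
  (HK0 : forall d, isK psi d (K0 d)) :
  lt_ct K0 (fun d => Nat.min (Kmax d) (Kmin d)) /\
  (le_ct Kmax KD /\ le_ct Kmin KD /\
   le_ct KD (fun d => (Kmax d + Nat.log2 (Kmax d)) + (Kmin d + Nat.log2 (Kmin d)))).
Proof.
  destruct HD as (Hi & Ht & Hrho & _).
  assert (Ht' : forall x y z, lt y x -> lt z y -> lt z x) by eauto.
  pose proof (proj1 Hphi) as Cphi. pose proof (proj1 HU) as CU. pose proof (proj1 HV) as CV.
  repeat split.
  - destruct (optimal_bound _ _ U K0 Hpsi (MaxPR_PC_Halt rho Hrho lt Hi Ht U CU) HK0) as [c1 H1].
    destruct (optimal_bound _ _ V K0 Hpsi
      (MaxPR_PC_Halt rho Hrho (fun x y => lt y x) Hi Ht' V CV) HK0) as [c2 H2].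
    exists (c1 + c2). intros d.
    destruct (HKmax d) as [(p & Hp & <-) _]. destruct (HKmin d) as [(q & Hq & <-) _].
    specialize (H1 p d Hp). specialize (H2 q d Hq). lia.
  - intros [c Hc]. destruct (Halt_avoid rho Hrho lt U V Hi Ht CU CV) as (theta & Ctheta & Ha).
    destruct (optimal_bound _ _ theta K0 Hpsi Ctheta HK0) as [c0 H0].
    (* With [N + 1 = 2 ^ (c + c0 + 1)], [K0 d] is at most [c + 2 * c0 + 1], so both minima would be
       at most [2 * c + 2 * c0 + 1], one less than the lower bound [2 * (c + c0 + 1)]. *)
    destruct (Ha (pred (2 ^ (c + c0 + 1)))) as (d & Hd & Hl).
    apply H0 in Hd. specialize (Hc d). rewrite length_bits in Hd.
    replace (S (pred (2 ^ (c + c0 + 1)))) with (2 ^ (c + c0 + 1)) in *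
      by (pose proof (Nat.pow_nonzero 2 (c + c0 + 1)); lia).
    rewrite Nat.log2_pow2 in * by lia.
    destruct (HKmax d) as [(p & Hp & Lp) _]. destruct (HKmin d) as [(q & Hq & Lq) _].
    pose proof (Hl p (or_introl Hp)). pose proof (Hl q (or_intror Hq)). lia.
  - destruct (optimal_bound _ _ phi Kmax HU (PC_MaxPR rho Hrho lt phi Cphi) HKmax) as [c H].
    exists c. intros d. destruct (HKD d) as [(p & Hp & <-) _]. auto.
  - destruct (optimal_bound _ _ phi Kmin HV
      (PC_MaxPR rho Hrho (fun x y => lt y x) phi Cphi) HKmin) as [c H].
    exists c. intros d. destruct (HKD d) as [(p & Hp & <-) _]. auto.
  - destruct (K_le_delim rho Hrho lt phi U V KD Hi Ht Hphi HKD CU CV) as [c1 H1].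
    (* Reversing the order exchanges [U] and [V], which gives the bound with the other string
       delimited. *)
    destruct (K_le_delim rho Hrho (fun x y => lt y x) phi V U KD Hi Ht' Hphi HKD CV CU) as [c2 H2].
    exists (c1 + c2). intros d.
    destruct (HKmax d) as [(p & Hp & <-) _]. destruct (HKmin d) as [(q & Hq & <-) _].
    specialize (H1 p q d Hp Hq). specialize (H2 q p d Hq Hp).
    destruct (le_lt_dec (length p) (length q)) as [L|L].
    + pose proof (Nat.log2_le_mono _ _ L). lia.
    + pose proof (Nat.log2_le_mono (length q) (length p) ltac:(lia)). lia.
Qed.
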